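(* The Euclid--Mullin graph $G_1$ is not a tree. In particular, each of the following nodes is connected to $1$ by two distinct paths in $G_1$: \begin{align*} 2&\cdot 3\cdot 7\cdot 43\cdot 139\cdot 50207\cdot 1607\cdot 38891\cdot 71609249149971437\cdot 104851\\ &\cdot 5914302068415095755097398828253214149923\\ &\cdot 103\cdot 1750880132687750604376675981842334069\\ &\cdot 103451\cdot 193\cdot 22133\cdot 5587528960270206397663051\\ &\cdot 73\cdot 5\cdot 13\cdot 593 \end{align*} and \begin{align*} 2&\cdot 3\cdot 7\cdot 43\cdot 139\cdot 50207\cdot 23\cdot 217733\cdot 4024572619121\\ &\cdot 539402497343\cdot 72208156847017648587223\cdot 79\\ &\cdot 7269452239696911635939429787229069136737446558564286318153183\\ &\cdot 8689\cdot 107\cdot 2895777621755988962510175673615781760909999040975810951\\ &\cdot 531543631\cdot 73\cdot 5\cdot 13\cdot 593. \end{align*} In each case, the order of the prime factors (read from left to right) indicates the sequence of edge labels of one path starting from $1$, and the other path is obtained by swapping $73$ and $593$ in this sequence.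
   Context: For a positive integer $n$, the directed graph $G_n$, whose nodes are positive integers, is defined recursively as follows. The integer $n$ is a node of $G_n$ (the root). If $m$ is a node of $G_n$ and $m+1=\prod_{i=1}^k p_i^{e_i}$ with $e_i>0$ is the prime factorization of $m+1$, then each of the integers $mp_1,\ldots,mp_k$ is a node of $G_n$, and $G_n$ has the directed edges $(m,mp_i)$ for $i=1,\ldots,k$; the edge $(m,mp_i)$ is labelled by the prime $p_i$. There are no other nodes or edges. Paths are directed paths. The graph $G_1$ is called the Euclid--Mullin graph. *)

(* Defs.v *)
From Stdlib Require Import PArith ZArith Znumtheory List.
Import ListNotations.
Local Open Scope positive_scope.

(** A walk is given by its starting vertex [x], the list [l] of the vertices
    visited after [x], and its final vertex [y]. *)
Fixpoint walk {V : Type} (E : V -> V -> Prop) (x : V) (l : list V) (y : V) : Prop :=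
  match l with
  | [] => x = y
  | v :: l' => E x v /\ walk E v l' y
  end.

Definition is_path {V : Type} (E : V -> V -> Prop) (x : V) (l : list V) (y : V) : Prop :=
  walk E x l y /\ NoDup (x :: l).

Definition adjacent {V : Type} (E : V -> V -> Prop) (x y : V) : Prop :=
  E x y \/ E y x.

Definition connected {V : Type} (N : V -> Prop) (E : V -> V -> Prop) : Prop :=
  forall x y : V, N x -> N y -> exists l : list V, is_path (adjacent E) x l y.

Definition is_cycle {V : Type} (E : V -> V -> Prop) (x : V) (l : list V) : Prop :=
  (2 <= length l)%nat /\ NoDup (x :: l) /\ walk E x (l ++ [x]) x.

(** A directed graph with node set [N] and edge relation [E] is a tree if its
    underlying undirected graph is connected and acyclic.  The graphs [G_n]
    below have no loops and no antiparallel edges, since the target of an edge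
    is larger than its source, so cycles of length 1 and 2 play no role. *)
Definition is_tree {V : Type} (N : V -> Prop) (E : V -> V -> Prop) : Prop :=
  (exists x : V, N x) /\ connected N E /\
  ~ (exists (x : V) (l : list V), is_cycle (adjacent E) x l).

(** The primes [p_i] in the factorization [m + 1 = p_1^e_1 ... p_k^e_k] with
    all [e_i > 0] are exactly the prime divisors of [m + 1]. *)
Definition prime_factor (p m : positive) : Prop :=
  prime (Zpos p) /\ (p | m).

Inductive node (n : positive) : positive -> Prop :=
| node_root : node n n
| node_child (m p : positive) : node n m -> prime_factor p (m + 1) -> node n (m * p).

Definition labelled_edge (n m p m' : positive) : Prop :=
  node n m /\ prime_factor p (m + 1) /\ m' = m * p.

Definition edge (n m m' : positive) : Prop :=
  exists p : positive, labelled_edge n m p m'.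

(** [has_labels n x l s]: [s] is the sequence of labels, in [G_n], of the
    edges joining consecutive vertices of [x :: l]. *)
Fixpoint has_labels (n x : positive) (l s : list positive) : Prop :=
  match l, s with
  | [], [] => True
  | v :: l', p :: s' => labelled_edge n x p v /\ has_labels n v l' s'
  | _, _ => False
  end.

Definition product (s : list positive) : positive := fold_right Pos.mul 1 s.

Definition swap (a b : positive) (s : list positive) : list positive :=
  map (fun p => if p =? a then b else if p =? b then a else p) s.

(** The vertex lists omit the common starting vertex 1. *)
Definition two_paths_from_1 (s t : list positive) (x : positive) : Prop :=
  node 1 x /\
  exists l1 l2 : list positive,
    l1 <> l2 /\
    is_path (edge 1) 1 l1 x /\ has_labels 1 1 l1 s /\
    is_path (edge 1) 1 l2 x /\ has_labels 1 1 l2 t.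

Definition labels1 : list positive :=
  [2; 3; 7; 43; 139; 50207; 1607; 38891; 71609249149971437; 104851;
   5914302068415095755097398828253214149923;
   103; 1750880132687750604376675981842334069;
   103451; 193; 22133; 5587528960270206397663051;
   73; 5; 13; 593].

Definition labels2 : list positive :=
  [2; 3; 7; 43; 139; 50207; 23; 217733; 4024572619121;
   539402497343; 72208156847017648587223; 79;
   7269452239696911635939429787229069136737446558564286318153183;
   8689; 107; 2895777621755988962510175673615781760909999040975810951;
   531543631; 73; 5; 13; 593].

(* Main.v *)
Require Import Defs.
From Stdlib Require Import PArith ZArith Znumtheory List.
From Stdlib Require Import Zpow_facts Permutation Lia Bool FinFun.
Import ListNotations.
Local Open Scope positive_scope.

(** In either sequence of labels, let [m] be the product of those preceding
    73.  Then [m + 1] is divisible both by 73 and by 593, and the two label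
    sequences 73, 5, 13, 593 and 593, 5, 13, 73 can both be followed from [m]:
    they lead to the same node, since they have the same product, but through
    different intermediate nodes.  The two branches together form an
    undirected cycle with 8 vertices, so [G_1] is not a tree
    ([cycle_of_two_walks]).

    Following a sequence of labels from 1 takes two kinds of facts about the
    labels.  That each label divides the successor of the product of the
    preceding ones is a computation ([follow_labels]).  That each label is
    prime is the real content, the largest label having 61 digits.  It is
    proved by a Pocklington-type criterion ([prime_of_power_order]): if some
    [b] has order exactly [F] modulo every divisor [d > 1] of [N], then every
    such [d] exceeds [F], and [N] is prime as soon as [N < (F + 1)^2].
    The order is controlled by the prime factors of [F], whose primality is
    established in the same way; so a list of certificates, sorted by size and
    starting from the prime 2, is checked by evaluation
    ([check_certificates_sound], [table_prime]). *)

(** * A primality criterion *)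

Section IntegerPrimes.
Local Open Scope Z_scope.

Lemma divide_pow_mul_sub_1 (d b k j : Z) :
  0 <= k -> 0 <= j -> (d | b ^ k - 1) -> (d | b ^ (k * j) - 1).
Proof.
intros Hk Hj Hd; rewrite Z.pow_mul_r by assumption; generalize dependent j.
apply natlike_ind.
- rewrite Z.pow_0_r, Z.sub_diag; apply Z.divide_0_r.
- intros j Hj IH; rewrite Z.pow_succ_r by assumption.
  replace (b ^ k * (b ^ k) ^ j - 1)
    with (b ^ k * ((b ^ k) ^ j - 1) + (b ^ k - 1)) by ring.
  now apply Z.divide_add_r; [apply Z.divide_mul_r|].
Qed.

(** The exponents [k] with [b ^ k = 1] modulo [d] form a subgroup of the
    integers; reducing one Bezout coefficient modulo [F] keeps the exponents
    that occur nonnegative. *)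
Lemma divide_pow_gcd_sub_1 (d b k F : Z) :
  0 < k -> 0 < F -> (d | b ^ k - 1) -> (d | b ^ F - 1) ->
  (d | b ^ Z.gcd k F - 1).
Proof.
intros Hk HF Hdk HdF.
destruct (Z.gcd_bezout k F _ eq_refl) as [u [v Huv]].
assert (Hg0 := Z.gcd_nonneg k F); assert (HgF := Z.gcd_divide_r k F).
apply Z.divide_pos_le in HgF; [|assumption].
set (g := Z.gcd k F) in *.
destruct (Z.eq_dec g F) as [->|HneF]; [assumption|].
assert (Hu := Z.mod_pos_bound u F HF); assert (Hdiv := Z.div_mod u F).
set (u' := u mod F) in *; set (w := - v - u / F * k).
assert (Hw : k * u' = g + F * w) by (unfold w; nia).
assert (0 <= w) by nia.
assert (Hku := divide_pow_mul_sub_1 d b k u' ltac:(lia) ltac:(lia) Hdk).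
rewrite Hw, Z.pow_add_r in Hku by nia.
replace (b ^ g - 1)
  with ((b ^ g * b ^ (F * w) - 1) - b ^ g * (b ^ (F * w) - 1)) by ring.
apply Z.divide_sub_r; [assumption|].
apply Z.divide_mul_r, divide_pow_mul_sub_1; auto with zarith.
Qed.

Definition Zproduct (qs : list Z) : Z := fold_right Z.mul 1 qs.

Lemma Zproduct_pos (qs : list Z) : Forall prime qs -> 0 < Zproduct qs.
Proof.
induction 1 as [|q qs Hq _ IH]; simpl; [lia|].
destruct Hq; nia.
Qed.

(** This is what the primality of the factors is needed for: any proper
    divisor of the product already divides the product with one of the listed
    factors removed, so finitely many exponents have to be tested. *)
Lemma proper_divisor_of_prime_product (qs : list Z) (g : Z) :
  Forall prime qs -> (g | Zproduct qs) -> 0 <= g ->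
  g = Zproduct qs \/ exists q, In q qs /\ (g * q | Zproduct qs).
Proof.
intros Hqs; revert g.
induction Hqs as [|q qs Hq Hqs IH]; simpl; intros g Hg Hg0.
- left; now apply Z.divide_1_r_nonneg.
- destruct (Zdivide_dec q g) as [[g' ->]|Hqg].
  + assert (1 < q) by now destruct Hq.
    rewrite (Z.mul_comm g') in Hg.
    apply Z.mul_divide_cancel_l in Hg; [|lia].
    destruct (IH g' Hg) as [->|[r [Hr Hgr]]]; [nia|left; ring|right].
    exists r; split; [now right|].
    replace (g' * q * r) with (q * (g' * r)) by ring.
    now apply Z.mul_divide_mono_l.
  + right; exists q; split; [now left|].
    rewrite (Z.mul_comm g); apply Z.mul_divide_mono_l.
    apply Gauss with q; [assumption|].
    now apply rel_prime_sym, prime_rel_prime.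
Qed.

(** If [b ^ k = 1] modulo [d] for some [0 < k < F], then [b ^ (F / q) = 1]
    for some prime factor [q] of [F]: the exponent can be replaced by
    [gcd k F], which is a proper divisor of [F]. *)
Lemma power_order (d b : Z) (qs : list Z) (F := Zproduct qs) :
  1 < d -> Forall prime qs -> (d | b ^ F - 1) ->
  (forall q, In q qs -> Z.gcd (b ^ (F / q) - 1) d = 1) ->
  forall k, 0 < k < F -> ~ (d | b ^ k - 1).
Proof.
intros Hd Hqs HdF Hgcd k Hk Hdk.
assert (HF : 0 < F) by now apply Zproduct_pos.
assert (Hdg := divide_pow_gcd_sub_1 d b k F ltac:(lia) HF Hdk HdF).
assert (Hgk : Z.gcd k F <= k)
  by (apply Z.divide_pos_le; [lia|apply Z.gcd_divide_l]).
destruct (proper_divisor_of_prime_product qs (Z.gcd k F) Hqs)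
  as [HgF|[q [Hq [c Hc]]]].
- apply Z.gcd_divide_r.
- apply Z.gcd_nonneg.
- fold F in HgF; lia.
- assert (1 < q) by (rewrite Forall_forall in Hqs; now destruct (Hqs q Hq)).
  fold F in Hc.
  assert (Hquot : F / q = Z.gcd k F * c).
  { replace F with (Z.gcd k F * c * q) at 1 by (rewrite Hc at 2; ring).
    apply Z.div_mul; lia. }
  specialize (Hgcd q Hq).
  assert (Hdq : (d | b ^ (F / q) - 1)).
  { assert (Hg := Z.gcd_nonneg k F).
    rewrite Hquot; apply divide_pow_mul_sub_1; [assumption|nia|assumption]. }
  assert (Hd1 : (d | 1)) by (rewrite <- Hgcd; apply Z.gcd_greatest;
                             [assumption|apply Z.divide_refl]).
  apply Z.divide_pos_le in Hd1; lia.
Qed.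

(** The powers [b ^ i] with [0 <= i < F] are distinct and nonzero modulo [d],
    so there are at most [d - 1] of them. *)
Lemma order_lt_modulus (d b F : Z) :
  1 < d -> 0 < F -> (d | b ^ F - 1) ->
  (forall k, 0 < k < F -> ~ (d | b ^ k - 1)) -> F < d.
Proof.
intros Hd HF HdF Hord.
set (power := fun i : nat => Z.to_nat (b ^ Z.of_nat i mod d)).
assert (Hrange : forall i, 0 <= b ^ Z.of_nat i mod d < d)
  by (intros i; apply Z.mod_pos_bound; lia).
(* Multiplying by [b ^ (F - i)] cancels the factor [b ^ i]. *)
assert (Hcancel : forall i x, 0 <= i <= F -> (d | b ^ i * x) -> (d | x)).
{ intros i x Hi Hdx.
  replace x with (b ^ (F - i) * (b ^ i * x) - (b ^ F - 1) * x).
  - now apply Z.divide_sub_r; [apply Z.divide_mul_r|apply Z.divide_mul_l].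
  - rewrite Z.mul_assoc, <- Z.pow_add_r, Z.sub_add by lia; ring. }
assert (Hneq : forall i j, (i < j)%nat -> Z.of_nat j < F -> power i <> power j).
{ intros i j Hij Hj Heq; unfold power in Heq.
  apply Z2Nat.inj in Heq; [|apply Hrange..].
  apply (Hord (Z.of_nat j - Z.of_nat i)); [lia|].
  apply (Hcancel (Z.of_nat i)); [lia|].
  rewrite Z.mul_sub_distr_l, <- Z.pow_add_r, Z.mul_1_r by lia.
  replace (Z.of_nat i + (Z.of_nat j - Z.of_nat i)) with (Z.of_nat j) by ring.
  apply Z.mod_divide; [lia|].
  rewrite Zminus_mod, Heq, Z.sub_diag; apply Z.mod_0_l; lia. }
assert (Hlen : (length (map power (seq 0 (Z.to_nat F)))
                <= length (seq 1 (Z.to_nat (d - 1))))%nat).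
{ apply NoDup_incl_length.
  - apply Injective_map_NoDup_in; [|apply seq_NoDup].
    intros i j Hi Hj Heq; apply in_seq in Hi, Hj.
    destruct (Nat.lt_trichotomy i j) as [Hij|[Hij|Hij]]; [|assumption|];
      exfalso; eapply Hneq; try eassumption; try lia; now symmetry.
  - intros r Hr; apply in_map_iff in Hr as [i [<- Hi]].
    apply in_seq in Hi; apply in_seq; unfold power.
    enough (b ^ Z.of_nat i mod d <> 0) by (specialize (Hrange i); lia).
    intros H0; apply Z.mod_divide in H0; [|lia].
    assert (Hd1 : (d | 1)).
    { apply (Hcancel (Z.of_nat i)); [lia|now rewrite Z.mul_1_r]. }
    apply Z.divide_pos_le in Hd1; lia. }
rewrite length_map, !length_seq in Hlen; lia.
Qed.

(** A variant of Pocklington's criterion.  The conditions on [b] modulo [N]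
    hold modulo every divisor of [N], so every divisor other than 1 exceeds
    [F]; a product of two such divisors is too large to be [N]. *)
Theorem prime_of_power_order (N b : Z) (qs : list Z) (F := Zproduct qs) :
  1 < N -> N < (F + 1) ^ 2 -> Forall prime qs -> (N | b ^ F - 1) ->
  (forall q, In q qs -> Z.gcd (b ^ (F / q) - 1) N = 1) ->
  prime N.
Proof.
intros HN HNF Hqs HbF Hgcd.
assert (HF : 0 < F) by now apply Zproduct_pos.
assert (Hdiv : forall d, 1 < d -> (d | N) -> F < d).
{ intros d Hd HdN.
  apply (order_lt_modulus d b); [assumption..|now apply Z.divide_trans with N|].
  apply power_order; [assumption..|now apply Z.divide_trans with N|].
  intros q Hq; apply Z.divide_1_r_nonneg; [apply Z.gcd_nonneg|].
  replace 1 with (Z.gcd (b ^ (F / q) - 1) N) at 2 by auto.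
  apply Z.gcd_greatest.
  - apply Z.gcd_divide_l.
  - eapply Z.divide_trans; [apply Z.gcd_divide_r|assumption]. }
apply prime_alt; split; [assumption|].
intros d Hd [e He].
assert (HFd : F < d) by (apply Hdiv; [lia|now exists e]).
assert (HFe : F < e) by (apply Hdiv; [nia|exists d; lia]).
nia.
Qed.

(** * Primality certificates *)

Definition Zmem (q : Z) (l : list Z) : bool := existsb (Z.eqb q) l.

Lemma Zmem_In (q : Z) (l : list Z) : Zmem q l = true -> In q l.
Proof.
intros H; apply existsb_exists in H as [r [Hr Hqr]].
now apply Z.eqb_eq in Hqr as ->.
Qed.

Lemma Forall_prime_of_Zmem (known qs : list Z) :
  Forall prime known -> forallb (fun q => Zmem q known) qs = true ->
  Forall prime qs.
Proof.
rewrite !Forall_forall, forallb_forall; intros Hknown Hqs q Hq.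
now apply Hknown, Zmem_In, Hqs.
Qed.

(** A certificate [(N, a, qs)] for the primality of [N] consists of a part
    [F], the product of [qs], of the factored [N - 1] and a base [a] such that
    [b = a ^ ((N - 1) / F)] has order [F] modulo [N]. *)
Definition certificate : Type := Z * Z * list Z.

Definition check_certificate (known : list Z) (c : certificate) : bool :=
  let '(N, a, qs) := c in
  let F := Zproduct qs in
  let b := Zpow_mod a ((N - 1) / F) N in
  (1 <? N) && (N <? (F + 1) ^ 2) && forallb (fun q => Zmem q known) qs &&
  (Zpow_mod b F N =? 1) &&
  forallb (fun q => Z.gcd (Zpow_mod b (F / q) N - 1) N =? 1) qs.

Fixpoint check_certificates (known : list Z) (cs : list certificate) : bool :=
  match cs with
  | [] => true
  | c :: cs' =>
      check_certificate known c && check_certificates (fst (fst c) :: known) cs'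
  end.

Lemma gcd_mod_sub_1 (x N : Z) :
  N <> 0 -> Z.gcd (x mod N - 1) N = Z.gcd (x - 1) N.
Proof.
intros HN; rewrite <- !(Z.gcd_comm N), <- Z.gcd_mod by assumption.
now rewrite Zminus_mod_idemp_l, Z.gcd_mod, Z.gcd_comm.
Qed.

Lemma check_certificate_sound (known : list Z) (c : certificate) :
  Forall prime known -> check_certificate known c = true -> prime (fst (fst c)).
Proof.
destruct c as [[N a] qs]; intros Hknown Hc; unfold check_certificate in Hc.
cbn [fst]; set (b := Zpow_mod a _ N) in Hc.
rewrite !andb_true_iff, Z.ltb_lt, Z.ltb_lt, Z.eqb_eq in Hc.
destruct Hc as [[[[HN HNF] Hqs] HbF] Hgcd].
apply prime_of_power_order with b qs; try assumption.
- now apply Forall_prime_of_Zmem with known.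
- rewrite Zpow_mod_correct in HbF by lia.
  apply Z.mod_divide; [lia|].
  rewrite Zminus_mod, HbF, (Z.mod_small 1), Z.sub_diag by lia.
  apply Z.mod_0_l; lia.
- intros q Hq; rewrite forallb_forall in Hgcd.
  specialize (Hgcd q Hq).
  now rewrite Z.eqb_eq, Zpow_mod_correct, gcd_mod_sub_1 in Hgcd by lia.
Qed.

Lemma check_certificates_sound (known : list Z) (cs : list certificate) :
  Forall prime known -> check_certificates known cs = true ->
  Forall prime (known ++ map (fun c => fst (fst c)) cs).
Proof.
revert known; induction cs as [|c cs IH]; simpl; intros known Hknown Hcs.
- now rewrite app_nil_r.
- apply andb_true_iff in Hcs as [Hc Hcs].
  assert (Hp := check_certificate_sound known c Hknown Hc).
  specialize (IH _ (Forall_cons _ Hp Hknown) Hcs).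
  rewrite Forall_app; inversion IH as [|? ? _ IH']; subst.
  rewrite Forall_app in IH'; destruct IH'; auto.
Qed.

(** The odd labels of the two paths, and the odd primes that occur in other
    certificates.  In most of them a single prime factor of [N - 1] is large
    enough to serve as [F]. *)
Definition certificates : list certificate :=
  [(3, 2, []); (5, 2, [2]); (7, 2, [3]); (11, 2, [5]); (13, 2, [3]);
   (17, 3, [2; 2]); (23, 2, [11]); (29, 2, [7]); (37, 2, [3; 3]);
   (41, 6, [5; 2]); (43, 2, [7]); (47, 2, [23]); (53, 2, [13]); (61, 2, [5; 3]);
   (67, 2, [11]); (71, 2, [7; 5]); (73, 2, [3; 3]); (79, 2, [13]);
   (103, 2, [17]); (107, 2, [53]); (109, 3, [3; 3; 3]); (137, 2, [17]);
   (139, 2, [23]); (151, 3, [5; 5]); (181, 2, [5; 3]); (193, 5, [3; 2; 2; 2]);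
   (199, 2, [11; 3]); (233, 2, [29]); (251, 3, [5; 5]); (293, 2, [73]);
   (313, 2, [13; 3]); (409, 2, [17; 3]); (503, 2, [251]); (557, 2, [139]);
   (593, 2, [37]); (857, 2, [107]); (1607, 2, [73]); (1877, 2, [67]);
   (1879, 2, [313]); (1931, 2, [193]); (2069, 2, [47]); (2143, 3, [17; 7]);
   (2441, 2, [61]); (3889, 5, [3; 3; 3; 3]); (4049, 2, [23; 11]);
   (4091, 2, [409]); (4481, 3, [7; 5; 2]); (5573, 2, [199]);
   (8053, 2, [61; 11]); (8689, 2, [181]); (11311, 2, [29; 13]);
   (22133, 2, [503]); (30853, 2, [857]); (38891, 2, [3889]); (50207, 2, [1931]);
   (66529, 3, [11; 7; 3; 3]); (86729, 2, [293; 37]); (87877, 2, [2441]);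
   (103451, 2, [2069]); (104851, 2, [233; 5]); (194353, 2, [4049]);
   (217733, 2, [1877]); (312089, 2, [5573]); (707191, 2, [2143]);
   (1110709, 2, [30853]); (1943531, 2, [194353]); (2333167, 2, [53; 29]);
   (14265049, 2, [109; 41]); (15548249, 2, [1943531]); (39028051, 2, [86729]);
   (89710421, 2, [8053; 557]); (531543631, 2, [4091; 71]);
   (9329342047, 2, [14265049]); (15004081819, 2, [4481; 1879]);
   (355121822651, 2, [66529; 151]); (539402497343, 2, [1110709]);
   (2840974581209, 2, [355121822651]); (4024572619121, 2, [39028051]);
   (24079501914901, 2, [87877; 137]); (3125072039329901, 2, [2840974581209]);
   (28703318658528847, 2, [15004081819]);
   (71609249149971437, 2, [312089; 11311]);
   (7461166072123383943, 2, [15548249; 2333167]);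
   (39587805288935114357, 2, [89710421; 707191]);
   (1504336600979534345567, 2, [39587805288935114357]);
   (12034692807836274764537, 2, [1504336600979534345567]);
   (72208156847017648587223, 2, [12034692807836274764537]);
   (419698145819251972045487, 2, [28703318658528847]);
   (5587528960270206397663051, 2, [3125072039329901]);
   (22796888972354094796561477951, 2, [7461166072123383943]);
   (2695806346511445851034787086221327, 2, [419698145819251972045487]);
   (9389633665232493638328653309575511, 2, [24079501914901; 9329342047]);
   (1750880132687750604376675981842334069, 2, [22796888972354094796561477951]);
   (5914302068415095755097398828253214149923, 2, [71609249149971437; 104851]);
   (2895777621755988962510175673615781760909999040975810951, 2, [2695806346511445851034787086221327]);
   (7269452239696911635939429787229069136737446558564286318153183, 2, [9389633665232493638328653309575511])].

Definition table : list Z := 2 :: map (fun c => fst (fst c)) certificates.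

Lemma table_prime : Forall prime table.
Proof.
apply (check_certificates_sound [2]).
- constructor; [exact prime_2|constructor].
- vm_compute; reflexivity.
Qed.

End IntegerPrimes.

(** * Following labels in the graph *)

Definition prime_labels (s : list positive) : Prop :=
  Forall (fun p => prime (Zpos p)) s.

Lemma prime_labels_of_table (s : list positive) :
  forallb (fun p => Zmem (Zpos p) table) s = true -> prime_labels s.
Proof.
intros Hs; apply Forall_forall; intros p Hp.
rewrite forallb_forall in Hs.
exact (proj1 (Forall_forall _ _) table_prime _ (Zmem_In _ _ (Hs p Hp))).
Qed.

Fixpoint visited (m : positive) (s : list positive) : list positive :=
  match s with
  | [] => []
  | p :: s' => m * p :: visited (m * p) s'
  end.

Fixpoint divides_successors (m : positive) (s : list positive) : bool :=
  match s with
  | [] => true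
  | p :: s' =>
      (Z.pos (m + 1) mod Z.pos p =? 0)%Z && divides_successors (m * p) s'
  end.

Lemma visited_gt (m : positive) (s : list positive) :
  prime_labels s -> Forall (fun v => m < v) (visited m s).
Proof.
intros Hs; revert m; induction Hs as [|p s Hp _ IH]; simpl; intros m;
  constructor.
- destruct Hp; nia.
- apply Forall_impl with (2 := IH (m * p)); intros v Hv.
  destruct Hp; nia.
Qed.

(** Vertices grow along directed walks, so these are paths. *)
Lemma visited_NoDup (m : positive) (s : list positive) :
  prime_labels s -> NoDup (m :: visited m s).
Proof.
intros Hs; constructor.
- intros Hm; apply visited_gt with (m := m) in Hs.
  rewrite Forall_forall in Hs; specialize (Hs m Hm); lia.
- revert m; induction Hs as [|p s Hp Hs IH]; simpl; intros m; constructor.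
  + intros Hm; apply visited_gt with (m := m * p) in Hs.
    rewrite Forall_forall in Hs; specialize (Hs _ Hm); lia.
  + apply IH.
Qed.

Lemma prime_factor_mod (p m : positive) :
  prime (Zpos p) -> (Z.pos m mod Z.pos p =? 0)%Z = true -> prime_factor p m.
Proof.
intros Hp Hmod; split; [assumption|].
apply Z.divide_Zpos, Z.mod_divide; [lia|now apply Z.eqb_eq].
Qed.

Theorem follow_labels (n m : positive) (s : list positive) :
  node n m -> prime_labels s -> divides_successors m s = true ->
  node n (m * product s) /\
  is_path (edge n) m (visited m s) (m * product s) /\
  has_labels n m (visited m s) s.
Proof.
intros Hm Hs Hdiv.
enough (node n (m * product s) /\
        walk (edge n) m (visited m s) (m * product s) /\
        has_labels n m (visited m s) s)
  by (unfold is_path; intuition auto using visited_NoDup).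
revert m Hm Hdiv; induction Hs as [|p s Hp Hs IH]; simpl; intros m Hm Hdiv.
- now rewrite Pos.mul_1_r.
- apply andb_true_iff in Hdiv as [Hp1 Hdiv].
  assert (Hpm := prime_factor_mod _ _ Hp Hp1).
  assert (Hnode := node_child n m p Hm Hpm).
  destruct (IH _ Hnode Hdiv) as [Hend [Hwalk Hlab]].
  rewrite <- Pos.mul_assoc in Hend, Hwalk.
  assert (Hedge : labelled_edge n m p (m * p)) by now split.
  split; [assumption|split; split; try assumption].
  now exists p.
Qed.

Lemma visited_inj (m : positive) (s t : list positive) :
  visited m s = visited m t -> s = t.
Proof.
revert m t; induction s as [|p s IH]; intros m [|q t]; simpl; try easy.
intros H; injection H as Hpq Hst; apply Pos.mul_reg_l in Hpq as ->.
f_equal; eauto.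
Qed.

Lemma two_paths_of_labels (s t : list positive) :
  s <> t -> product s = product t -> prime_labels s -> prime_labels t ->
  divides_successors 1 s = true -> divides_successors 1 t = true ->
  two_paths_from_1 s t (product s).
Proof.
intros Hst Hprod Hs Ht Hdivs Hdivt.
destruct (follow_labels 1 1 s (node_root 1) Hs Hdivs) as [Hnode [Hps Hls]].
destruct (follow_labels 1 1 t (node_root 1) Ht Hdivt) as [_ [Hpt Hlt]].
rewrite Pos.mul_1_l in *; rewrite <- Hprod in Hpt.
split; [assumption|].
exists (visited 1 s), (visited 1 t); repeat split; try assumption;
  [|apply Hps..|apply Hpt|apply Hpt].
intros H; now apply visited_inj in H.
Qed.

(** * Two directed walks with common ends form a cycle *)

Lemma walk_app {V : Type} (E : V -> V -> Prop) (x y z : V) (l l' : list V) :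
  walk E x l y -> walk E y l' z -> walk E x (l ++ l') z.
Proof.
revert x; induction l as [|v l IH]; simpl; intros x.
- now intros ->.
- intros [Hxv Hl] Hl'; auto.
Qed.

Lemma walk_adjacent {V : Type} (E : V -> V -> Prop) (x y : V) (l : list V) :
  walk E x l y -> walk (adjacent E) x l y.
Proof.
revert x; induction l as [|v l IH]; simpl; intros x; [trivial|].
intros [Hxv Hl]; split; [now left|auto].
Qed.

Lemma walk_backwards {V : Type} (E : V -> V -> Prop) (x y : V) (l : list V) :
  walk E x (l ++ [y]) y -> walk (adjacent E) y (rev l ++ [x]) x.
Proof.
revert x; induction l as [|v l IH]; simpl; intros x [Hxv Hl].
- split; [now right|reflexivity].
- apply walk_app with v; [now apply IH|].
  split; [now right|reflexivity].
Qed.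

(** The cycle goes along the first walk and returns along the second. *)
Lemma cycle_of_two_walks {V : Type} (E : V -> V -> Prop) (x y : V)
    (l1 l2 : list V) :
  (1 <= length l1)%nat -> NoDup (x :: l1 ++ y :: l2) ->
  walk E x (l1 ++ [y]) y -> walk E x (l2 ++ [y]) y ->
  is_cycle (adjacent E) x (l1 ++ y :: rev l2).
Proof.
intros Hlen Hnodup H1 H2; split; [|split].
- rewrite length_app; simpl; lia.
- apply Permutation_NoDup with (2 := Hnodup).
  apply perm_skip, Permutation_app_head, perm_skip, Permutation_rev.
- change (y :: rev l2) with ([y] ++ rev l2); rewrite app_assoc, <- app_assoc.
  apply walk_app with y; [now apply walk_adjacent|].
  now apply walk_backwards.
Qed.

Lemma NoDup_of_nodup (l : list positive) : nodup Pos.eq_dec l = l -> NoDup l.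
Proof. intros <-; apply NoDup_nodup. Qed.

(** * The two pairs of paths *)

Lemma labels1_prime : prime_labels labels1.
Proof. apply prime_labels_of_table; vm_compute; reflexivity. Qed.

Lemma labels2_prime : prime_labels labels2.
Proof. apply prime_labels_of_table; vm_compute; reflexivity. Qed.

Lemma swap_prime (a b : positive) (s : list positive) :
  In a s -> In b s -> prime_labels s -> prime_labels (swap a b s).
Proof.
unfold prime_labels; rewrite !Forall_forall; intros Ha Hb Hs p Hp.
apply in_map_iff in Hp as [q [<- Hq]].
destruct (q =? a); [|destruct (q =? b)]; auto.
Qed.

(** The node of [G_1] where the two paths of the first pair split. *)
Definition branching_node : positive := product (firstn 17 labels1).

Lemma node_branching_node : node 1 branching_node.
Proof.
assert (Hlabels : prime_labels (firstn 17 labels1))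
  by (apply prime_labels_of_table; vm_compute; reflexivity).
destruct (follow_labels 1 1 (firstn 17 labels1) (node_root 1) Hlabels)
  as [Hnode _]; [vm_compute; reflexivity|].
rewrite Pos.mul_1_l in Hnode; exact Hnode.
Qed.

Lemma G1_not_tree : ~ is_tree (node 1) (edge 1).
Proof.
intros [_ [_ Hacyclic]]; apply Hacyclic.
set (m := branching_node); set (y := m * product [73; 5; 13; 593]).
assert (Hlabels : prime_labels [73; 5; 13; 593])
  by (apply prime_labels_of_table; vm_compute; reflexivity).
assert (Hlabels' : prime_labels [593; 5; 13; 73])
  by (apply (swap_prime 73 593) in Hlabels; [exact Hlabels|simpl; tauto..]).
exists m, (visited m [73; 5; 13] ++ y :: rev (visited m [593; 5; 13])).
apply cycle_of_two_walks.
- simpl; lia.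
- apply NoDup_of_nodup; vm_compute; reflexivity.
- replace (_ ++ [y]) with (visited m [73; 5; 13; 593])
    by (vm_compute; reflexivity).
  apply follow_labels;
    [exact node_branching_node|assumption|vm_compute; reflexivity].
- replace (_ ++ [y]) with (visited m [593; 5; 13; 73])
    by (vm_compute; reflexivity).
  replace y with (m * product [593; 5; 13; 73]) by (vm_compute; reflexivity).
  apply follow_labels;
    [exact node_branching_node|assumption|vm_compute; reflexivity].
Qed.

Theorem theorem1p1 :
  ~ is_tree (node 1) (edge 1) /\
  two_paths_from_1 labels1 (swap 73 593 labels1) (product labels1) /\
  two_paths_from_1 labels2 (swap 73 593 labels2) (product labels2).
Proof.
split; [exact G1_not_tree|split]; apply two_paths_of_labels;
  auto using labels1_prime, labels2_prime;
  try (vm_compute; reflexivity); try (vm_compute; discriminate);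
  apply swap_prime; auto using labels1_prime, labels2_prime;
  simpl; tauto.
Qed.
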